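(* Let $A$ be a compactly generated locally compact abelian group and $M$ a compactly generated LC $A$-module. Then for every ascending sequence $M_0\subseteq M_1\subseteq\cdots$ of closed submodules of $M$, there exists $n_0$ such that for all $n\ge n_0$, $M_n$ is cocompact in $\overline{\bigcup_i M_i}$.
   Context: An LC $A$-module is an LCA group with a continuous action of $A$ by topological automorphisms. $M$ is compactly generated if there is a compact subset $K\subseteq M$ such that the $A$-submodule generated (algebraically) by $K$ is $M$. *)

(* Defs.v *)
From HB Require Import structures.
From mathcomp Require Import all_boot all_order all_algebra.
From mathcomp Require Import all_classical all_reals all_analysis.
Set Implicit Arguments. Unset Strict Implicit. Unset Printing Implicit Defensive.
Import Order.TTheory GRing.Theory Num.Theory.
Local Open Scope classical_set_scope.
Local Open Scope ring_scope.

Definition LCA (G : topologicalZmodType) : Prop :=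
  hausdorff_space G /\ locally_compact [set: G].

Definition is_subgroup (G : zmodType) (H : set G) : Prop :=
  H 0 /\ (forall x y, H x -> H y -> H (x - y)).

Definition subgroup_gen (G : zmodType) (K : set G) : set G :=
  [set x | forall H : set G, is_subgroup H -> K `<=` H -> H x].

Definition compactly_generated_group (G : topologicalZmodType) : Prop :=
  exists K : set G, compact K /\ subgroup_gen K = [set: G].

(* A continuous action of A on M by topological group automorphisms
   (the inverse of act a is act (- a), hence continuous as well). *)
Definition LC_action (A M : topologicalZmodType) (act : A -> M -> M) : Prop :=
  [/\ continuous (fun p : A * M => act p.1 p.2),
      (forall m, act 0 m = m),
      (forall a b m, act (a + b) m = act a (act b m)) &
      (forall a x y, act a (x + y) = act a x + act a y)].

Definition is_submodule (A M : topologicalZmodType) (act : A -> M -> M)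
    (N : set M) : Prop :=
  is_subgroup N /\ (forall a x, N x -> N (act a x)).

Definition submodule_gen (A M : topologicalZmodType) (act : A -> M -> M)
    (K : set M) : set M :=
  [set x | forall N : set M, is_submodule act N -> K `<=` N -> N x].

Definition compactly_generated_module (A M : topologicalZmodType)
    (act : A -> M -> M) : Prop :=
  exists K : set M, compact K /\ submodule_gen act K = [set: M].

Definition cocompact_in (M : topologicalZmodType) (H N : set M) : Prop :=
  exists K : set M, compact K /\ N = [set h + k | h in H & k in K].

(* Main.v *)
Require Import Defs.
From HB Require Import structures.
From mathcomp Require Import all_boot all_order all_algebra.
From mathcomp Require Import all_classical all_reals all_analysis.
From mathcomp Require Import zify ring.
Set Implicit Arguments. Unset Strict Implicit. Unset Printing Implicit Defensive.
Import Order.TTheory GRing.Theory Num.Theory.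
Local Open Scope classical_set_scope.
Local Open Scope ring_scope.

(** No structure theory of locally compact groups is needed.  Covering compact
    sets by finitely many translates of a compact neighbourhood V of 0 gives
    A = <F> + V with F finite, and then, for a compact neighbourhood W of 0 in
    M, M = N + W where N is a module generated by finitely many elements over a
    polynomial ring R over the integers, whose variables act as the elements of
    F and their opposites.  If phi is the map from the free module R^k onto N,
    the sets L_n = phi^-1 (M_n + W) are submodules of R^k up to an error in a
    finite set independent of n.  A coarse version of Hilbert's basis theorem
    says that an ascending chain of such approximate submodules is stationary up
    to finite sets, i.e. the union of the L_i lies in L_n + E with E finite;
    pushing this forward by phi, the union of the M_i lies in M_n plus a compact
    set. *)

(** * Ascending chains of sets *)

Lemma chain_le (T : Type) (L : nat -> set T) :
  (forall n, L n `<=` L n.+1) -> forall m n, (m <= n)%N -> L m `<=` L n.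
Proof.
by move=> LS m n /subnK <-; elim: (n - m)%N => [//|k IH] x /IH /LS.
Qed.

Lemma finite_sub_chain (T : Type) (L : nat -> set T) (E : set T) :
  (forall n, L n `<=` L n.+1) -> finite_set E -> E `<=` \bigcup_n L n ->
  exists n, E `<=` L n.
Proof.
move=> LS /finite_setP[k]; elim: k E => [|k IH] E.
  by rewrite II0 card_eq0 => /eqP -> _; exists 0%N.
move=> /eq_cardSP[x Ex /IH{}IH] EL.
have [n nE] : exists n, E `\ x `<=` L n by apply: IH => y [/EL].
have [m _ mx] := EL _ Ex.
exists (maxn m n) => y Ey; have [->|yx] := pselect (y = x).
  exact: (chain_le LS (leq_maxl _ _) mx).
apply: (chain_le LS (leq_maxr _ _)); exact: nE.
Qed.

(** * Approximate submodules and the coarse ascending chain condition *)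

Section CoarseNoetherian.
Variable G : comNzRingType.
Implicit Types (X F H L E : set G).

(* For F = [set 0] these are the subgroups of G stable under multiplication by
   the elements of X; in general the closure properties hold up to an error
   in F. *)
Definition approx_submodule X F L :=
  [/\ L 0,
      forall x y, L x -> L y -> exists2 f, F f & L (x - y + f) &
      forall c x, X c -> L x -> exists2 f, F f & L (c * x + f)].

Definition coarsely_noetherian X H := forall F (L : nat -> set G),
  finite_set F -> (forall n, L n `<=` H) -> (forall n, L n `<=` L n.+1) ->
  (forall n, approx_submodule X F (L n)) ->
  exists n E, finite_set E /\
    forall m x, L m x -> exists2 e, E e & L n (x - e).

(** The sum is formed as [x - (0 - y)], which costs two errors. *)
Lemma approx_submodule_add X F L : approx_submodule X F L ->
  forall x y, L x -> L y ->
  exists f g, [/\ F f, F g & L (x + y + (f - g))].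
Proof.
case=> L0 LB _ x y Lx Ly; have [g Fg Lg] := LB _ _ L0 Ly.
have [f Ff Lf] := LB _ _ Lx Lg; exists f, g; split=> //.
by move: Lf; congr (L _); ring.
Qed.

Lemma approx_submoduleS X F F' L : F `<=` F' ->
  approx_submodule X F L -> approx_submodule X F' L.
Proof.
move=> FF' [L0 LB LX]; split=> // [x y Lx Ly|c x Xc Lx].
  by have [f /FF'] := LB _ _ Lx Ly; exists f.
by have [f /FF'] := LX _ _ Xc Lx; exists f.
Qed.

(** For exact submodules the finite error disappears: an error [e = x - (x - e)] that occurs lies in
    the union of the chain, and all such elements of [E] already lie in one [I p]. *)
Lemma coarsely_noetherian_chain X H (I : nat -> set G) :
  coarsely_noetherian X H ->
  (forall n, I n `<=` H) -> (forall n, I n `<=` I n.+1) ->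
  (forall n, approx_submodule X [set 0] (I n)) ->
  exists n, forall m, I m `<=` I n.
Proof.
move=> HN IH IS Isub.
have IB n x y : I n x -> I n y -> I n (x - y).
  move=> Ix Iy; have [_ IB _] := Isub n.
  by have [f ->] := IB _ _ Ix Iy; rewrite addr0.
have [n [E [finE nE]]] := HN _ _ (finite_set1 0) IH IS Isub.
have [p pE] : exists p, E `&` \bigcup_n I n `<=` I p.
  by apply: finite_sub_chain => //; exact: finite_setIl.
exists (maxn n p) => m x Imx; have [e Ee Ixe] := nE _ _ Imx.
have Ie : I p e.
  apply: pE; split=> //; exists (maxn m n) => //.
  rewrite -[e](subKr x); apply: IB; first exact: (chain_le IS (leq_maxl _ _)).
  exact: (chain_le IS (leq_maxr _ _)).
have /(chain_le IS (leq_maxr n p)) I1 := Ie.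
have /(chain_le IS (leq_maxl n p)) I2 := Ixe.
have I0 : I (maxn n p) 0 by have [] := Isub (maxn n p).
have /(IB _ _ _ I2) := IB _ _ _ I0 I1; congr (I _ _); ring.
Qed.

End CoarseNoetherian.

(* An element of L whose image under pi is one of the finitely many values
   taken on error terms is moved into the kernel of pi by subtracting a fixed
   element z of the union of the chain with the same image; this makes the
   traces on the kernel approximate submodules with uniform error. *)
Lemma coarsely_noetherian_ext (G R : comNzRingType) (X H : set G)
    (pi : {additive G -> R}) (gam : G -> R) :
  (forall c x, X c -> pi (c * x) = gam c * pi x) ->
  finite_set X -> is_subgroup H ->
  coarsely_noetherian (gam @` X) [set: R] ->
  coarsely_noetherian X (H `&` [set x | pi x = 0]) ->
  coarsely_noetherian X H.
Proof.
move=> piM finX [H0 HB] RN KN F0 L finF0 LH LS Lsub0.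
pose F := 0 |` F0.
have finF : finite_set F by rewrite finite_setU; split; [exact: finite_set1|].
have F0F : F0 `<=` F by move=> f; right.
have Lsub n : approx_submodule X F (L n) := approx_submoduleS F0F (Lsub0 n).
have Lle := chain_le LS.
have [n0 [E [finE n0E]]] : exists n E, finite_set E /\
    forall m x, (pi @` L m) x -> exists2 e, E e & (pi @` L n) (x - e).
  apply: (RN (pi @` F)) => //; first exact: finite_image.
    by move=> n _ [x /LS Lx <-]; exists x.
  move=> n; have [L0 LB LX] := Lsub n; split; first by exists 0; rewrite ?raddf0.
    move=> _ _ [x Lx <-] [y Ly <-]; have [f Ff Lf] := LB _ _ Lx Ly.
    by exists (pi f); [exists f | exists (x - y + f); rewrite ?(raddfD pi, raddfN pi)].
  move=> _ _ [c Xc <-] [x Lx <-]; have [f Ff Lf] := LX _ _ Xc Lx.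
  by exists (pi f); [exists f | exists (c * x + f); rewrite ?raddfD ?piM].
(* [z j] lies in the union of the chain and has image [j] if such an element exists; otherwise it is
   [0]. *)
have /choice[z zP] : forall j : R, exists z, forall m x, L m x -> pi x = j ->
    pi z = j /\ exists k, L k z.
  move=> j; have [[m [x [Lx <-]]]|nx] := pselect (exists m x, L m x /\ pi x = j).
    by exists x => _ _ _ _; split=> //; exists m.
  by exists 0 => m x Lx xj; case: nx; exists m, x.
(* These are the error terms met when elements of the sets [K m] below are subtracted or multiplied
   by an element of [X]. *)
pose U := [set fg + h | fg in [set f - g | f in F & g in F] & h in F] `|`
          [set cf + h | cf in [set c * f | c in X & f in F] & h in F].
have finU : finite_set U.
  rewrite finite_setU; split; apply: finite_image2 => //; exact: finite_image2.
pose J := z @` (pi @` U).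
have finJ : finite_set J by do 2 apply: finite_image.
have [n1 n1J] : exists n, J `&` \bigcup_n L n `<=` L n.
  by apply: finite_sub_chain => //; exact: finite_setIl.
pose N1 := maxn n0 n1.
(* The trace on the kernel is thickened by [F] because subtracting [w] stays in [L m] only up to an
   error. *)
pose K m := [set v | [/\ H v, pi v = 0 & exists2 f, F f & L m (v + f)]].
have KLB m x w : L m x -> L m w -> pi x = pi w -> K m (x - w).
  move=> Lx Lw xw; have [_ LB _] := Lsub m; split; last exact: LB.
    by apply: HB; [exact: (LH m _ Lx) | exact: (LH m _ Lw)].
  by rewrite raddfB xw subrr.
have KU m x u : (N1 <= m)%N -> L m x -> U u -> pi x = pi u ->
    exists2 w, J w & K m (x - w).
  move=> N1m Lx Uu xu; have [zx [k Lkz]] := zP _ _ _ Lx xu.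
  have Jz : J (z (pi u)) by exists (pi u) => //; exists u.
  exists (z (pi u)) => //; apply: KLB => //; last by rewrite zx.
  apply: (Lle n1); first exact: leq_trans (leq_maxr _ _) N1m.
  by apply: n1J; split=> //; exists k.
have [i [E' [finE' iE']]] : exists n E, finite_set E /\
    forall m x, K (N1 + m)%N x -> exists2 e, E e & K (N1 + n)%N (x - e).
  apply: (KN [set u - w | u in U & w in J]).
  - exact: finite_image2.
  - by move=> n x [].
  - move=> n x [Hx px [f Ff Lf]]; split=> //; exists f => //.
    by rewrite addnS; exact: LS.
  - move=> n; set m := (N1 + n)%N; have N1m : (N1 <= m)%N by exact: leq_addr.
    have [L0 LB LX] := Lsub m; split.
    + by split; rewrite ?raddf0//; exists 0; [left | rewrite addr0].
    + move=> x y [Hx px [f Ff Lf]] [Hy py [g Fg Lg]].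
      have [h Fh Lh] := LB _ _ Lf Lg.
      have Uu : U (f - g + h).
        by left; exists (f - g); [exists f => //; exists g|exists h].
      have [] := KU _ _ _ N1m Lh Uu.
        by rewrite !(raddfD pi, raddfN pi) px py; ring.
      move=> w Jw Kw; exists (f - g + h - w).
        by exists (f - g + h) => //; exists w.
      by move: Kw; congr (K _ _); ring.
    + move=> c x Xc [Hx px [f Ff Lf]].
      have [h Fh Lh] := LX _ _ Xc Lf.
      have Uu : U (c * f + h).
        by right; exists (c * f); [exists c => //; exists f|exists h].
      have [] := KU _ _ _ N1m Lh Uu.
        by rewrite !(raddfD pi) !piM// raddfD px; ring.
      move=> w Jw Kw; exists (c * f + h - w).
        by exists (c * f + h) => //; exists w.
      by move: Kw; congr (K _ _); ring.
pose n := (N1 + i)%N; exists n.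
pose Z := z @` [set e + j | e in E & j in pi @` F].
pose D := [set f - g | f in F & g in F].
pose V := [set d + t | d in D &
  t in [set w + t | w in Z &
    t in [set e - d | e in E' & d in [set f + g | f in F & g in F]]]].
exists V; split.
  apply: finite_image2; first exact: finite_image2.
  apply: finite_image2; last by apply: finite_image2 => //; exact: finite_image2.
  by apply/finite_image/finite_image2 => //; exact: finite_image.
move=> m0 x Lm0x.
have [e Ee [y Ly yE]] := n0E m0 _ (imageP pi Lm0x).
pose m := maxn m0 n.
have Lx : L m x := Lle _ _ (leq_maxl _ _) _ Lm0x.
have n0n : (n0 <= n)%N by apply: leq_trans (leq_addr _ _); exact: leq_maxl.
have Lny : L n y := Lle _ _ n0n _ Ly.
have [_ LB _] := Lsub m.
have [f Ff Ll] := LB _ _ Lx (Lle _ _ (leq_maxr _ _) _ Lny).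
set l := x - y + f in Ll.
have pil : pi l = e + pi f by rewrite !(raddfD pi, raddfN pi) yE; ring.
have [zl [k Lkz]] := zP _ _ _ Ll pil.
have Zz : Z (z (e + pi f)).
  by exists (e + pi f) => //; exists e => //; exists (pi f) => //; exists f.
set w := z (e + pi f) in zl Lkz Zz.
(* The stage [p] depends on [x], which is harmless: [E'] and [n] do not. *)
pose p := maxn m k.
have N1p : (N1 <= p)%N.
  by rewrite !leq_max leq_addr orbT.
have Kp : K p (l - w).
  apply: KLB; [exact: (Lle _ _ (leq_maxl _ _) _ Ll)| |by rewrite pil zl].
  exact: (Lle _ _ (leq_maxr _ _) _ Lkz).
move: Kp; rewrite -(subnKC N1p) => /iE'[e' E'e' [_ _ [g Fg Lg]]].
have [d [d' [Fd Fd' Ld]]] := approx_submodule_add (Lsub n) Lny Lg.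
exists (d' - d + (w + (e' - (f + g)))); last first.
  by move: Ld; congr (L _ _); rewrite /l; ring.
exists (d' - d); first by exists d' => //; exists d.
exists (w + (e' - (f + g))) => //; exists w => //.
exists (e' - (f + g)) => //; exists e' => //.
by exists (f + g) => //; exists f => //; exists g.
Qed.

(** * The coarse chain condition for the integers *)

Lemma finite_set_int_le (B : int) : finite_set [set z : int | `|z| <= B].
Proof.
apply: (@sub_finite_set _ _ ((fun n : nat => (n : int)) @` `I_(`|B|.+1) `|`
   (fun n : nat => - (n : int)) @` `I_(`|B|.+1))).
  move=> z /= zB; have [z0|z0] := leP 0 z.
    by left; exists `|z|%N => /=; lia.
  by right; exists `|z|%N => /=; lia.
by rewrite finite_setU; split; apply: finite_image; exact: finite_II.
Qed.

Lemma finite_int_bounded (F : set int) : finite_set F ->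
  exists B, forall f, F f -> `|f| <= B.
Proof.
move=> finF.
have [|f _|n nF] := finite_sub_chain
  (L := fun n => [set z : int | `|z| <= n%:Z]) _ finF.
- by move=> n z /=; lia.
- by exists `|f|%N => //=.
- by exists n%:Z.
Qed.

(** A bounded chain lies in a finite set. Otherwise some [L n] contains an [l] exceeding the error
    of an addition, and steps of about [l] in both directions come within a fixed distance of every
    integer. *)
Lemma coarsely_noetherian_int : coarsely_noetherian set0 [set: int].
Proof.
move=> F L finF _ LS Lsub; have [B FB] := finite_int_bounded finF.
(* Changing a sign costs at most [|B|], so an element beyond [3 * |B|] yields a positive [l] beyond
   [2 * |B|], the error of an addition. *)
have [Lb|] := pselect (forall m x, L m x -> `|x| <= 3 * `|B|).
  exists 0%N, [set z : int | `|z| <= 3 * `|B|]; split.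
    exact: finite_set_int_le.
  move=> m x Lx; exists x; first exact: Lb Lx.
  by rewrite subrr; case: (Lsub 0%N).
move=> /existsNP[n] /existsNP[l0] /not_implyP[Ll0 l0B]; exists n.
have [L0 LB _] := Lsub n.
have [l Ll lB] : exists2 l, L n l & 2 * `|B| < l.
  have [l0p|l0n] := leP 0 l0; first by exists l0 => //; lia.
  have [f Ff Lf] := LB _ _ L0 Ll0; exists (0 - l0 + f) => //.
  by have := FB _ Ff; lia.
exists [set z : int | `|z| <= l + 2 * `|B|]; split.
  exact: finite_set_int_le.
suff near x : exists2 y, L n y & `|x - y| <= l + 2 * `|B|.
  by move=> _ x _; have [y Ly xy] := near x; exists (x - y) => //; rewrite subKr.
elim/int_ind: x => [|k [y Ly ky]|k [y Ly ky]].
- by exists 0 => //; lia.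
- have [ky1|ky1] := leP `|k.+1%:Z - y| (l + 2 * `|B|); first by exists y.
  have [f [g [/FB fB /FB gB Lfg]]] := approx_submodule_add (Lsub n) Ly Ll.
  by exists (y + l + (f - g)) => //; lia.
- have [ky1|ky1] := leP `|- k.+1%:Z - y| (l + 2 * `|B|); first by exists y.
  have [f /FB fB Lf] := LB _ _ Ly Ll.
  by exists (y - l + f) => //; lia.
Qed.

(** * A coarse Hilbert basis theorem *)

Section Hilbert.
Variable R : comNzRingType.
Implicit Types (X : set R) (p q : {poly R}).

Lemma size_polyB_le D p q :
  (size p <= D)%N -> (size q <= D)%N -> (size (p - q)%R <= D)%N.
Proof.
by move=> pD qD; rewrite (leq_trans (size_polyD _ _))// geq_max size_polyN pD.
Qed.

Lemma size_polyD_le D p q :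
  (size p <= D)%N -> (size q <= D)%N -> (size (p + q)%R <= D)%N.
Proof. by move=> pD qD; rewrite (leq_trans (size_polyD _ _))// geq_max pD. Qed.

Lemma size_le_coef0 D p : (size p <= D.+1)%N -> p`_D = 0 -> (size p <= D)%N.
Proof.
move=> /leq_sizeP pD pD0; apply/leq_sizeP => j.
by rewrite leq_eqVlt => /predU1P[<-//|]; exact: pD.
Qed.

(** Induction on [D], splitting off the top coefficient: its values lie in [R], and its kernel is
    the case of smaller size. *)
Lemma coarsely_noetherian_poly_size X D : finite_set X ->
  coarsely_noetherian X [set: R] ->
  coarsely_noetherian (polyC @` X) [set p : {poly R} | (size p <= D)%N].
Proof.
move=> finX RN; elim: D => [|D IH].
  move=> F L finF LH _ Lsub; exists 0%N, [set 0]; split; first exact: finite_set1.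
  move=> m x Lx; exists 0 => //; have := LH _ _ Lx.
  by rewrite /= leqn0 size_poly_eq0 => /eqP ->; rewrite subr0; case: (Lsub 0%N).
apply: (@coarsely_noetherian_ext _ R _ _ (coefp D) (coefp 0)).
- by move=> _ p [c _ <-]; rewrite /= coefCM coefC.
- exact: finite_image.
- by split=> [|p q]; [rewrite /= size_poly0 | exact: size_polyB_le].
- rewrite (_ : [set _ | _ in _] = X)//; apply/seteqP; split=> x.
    by move=> [_ [c Xc <-] <-]; rewrite /= coefC.
  by move=> Xx; exists x%:P; [exists x | rewrite /= coefC].
- rewrite (_ : _ `&` _ = [set p : {poly R} | (size p <= D)%N])//.
  apply/seteqP; split=> p /= => [[pD pD0]|pD]; first exact: size_le_coef0.
  by split; [exact: leqW | exact: nth_default].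
Qed.

(* As in Hilbert's basis theorem, but beyond the degree of the errors in F the
   leading coefficients form genuine submodules, so that only the polynomials
   of degree less than D have to be treated coarsely. *)
Lemma coarsely_noetherian_poly X : finite_set X ->
  coarsely_noetherian X [set: R] ->
  coarsely_noetherian ('X |` polyC @` X) [set: {poly R}].
Proof.
move=> finX RN F L finF _ LS Lsub; have Lle := chain_le LS.
have [D FD] : exists D, F `<=` [set p : {poly R} | (size p <= D)%N].
  apply: (@finite_sub_chain _ (fun D => [set p : {poly R} | (size p <= D)%N])).
  - by move=> n p /=; exact: leqW.
  - by [].
  - by move=> p _; exists (size p) => /=.
(* The shift by [D] keeps the errors, of size at most [D], away from the recorded coefficient. *)
pose I n d := [set a | exists2 p, L n p &
  (size p <= (D + d).+1)%N /\ p`_(D + d) = a].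
have FDd d f : F f -> (size f <= D + d)%N.
  by move=> /FD /= /leq_trans; apply; exact: leq_addr.
have Fcoef d f : F f -> f`_(D + d) = 0.
  by move=> /(FDd d) ?; exact: nth_default.
have Isub n d : approx_submodule X [set 0] (I n d).
  have [L0 LB LX] := Lsub n; split.
  - by exists 0 => //; rewrite size_poly0 coef0.
  - move=> _ _ [p Lp [pd <-]] [q Lq [qd <-]]; exists 0 => //.
    have [f Ff Lf] := LB _ _ Lp Lq; exists (p - q + f) => //; split.
      by apply: size_polyD_le; [exact: size_polyB_le | exact/leqW/FDd].
    by rewrite coefD coefB (Fcoef _ _ Ff).
  - move=> c _ Xc [p Lp [pd <-]]; exists 0 => //.
    have [|f Ff Lf] := LX c%:P p _ Lp; first by right; exists c.
    exists (c%:P * p + f) => //; split.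
      apply: size_polyD_le; last exact/leqW/FDd.
      by rewrite mul_polyC (leq_trans (size_scale_leq _ _)).
    by rewrite coefD coefCM (Fcoef _ _ Ff).
have ISn d n : I n d `<=` I n.+1 d.
  by move=> a [p /LS Lp pa]; exists p.
have ISd n d : I n d `<=` I n d.+1.
  move=> _ [p Lp [pd <-]]; have [_ _ LX] := Lsub n.
  have [|f Ff Lf] := LX 'X p _ Lp; first by left.
  exists ('X * p + f) => //; split.
    apply: size_polyD_le; last exact/leqW/FDd.
    apply: leq_trans (size_polyMleq _ _) _.
    by rewrite size_polyX addnS.
  by rewrite coefD (Fcoef _ _ Ff) addr0 mulrC coefMX addnS.
have Ilen d := chain_le (ISn d).
have Iled n := chain_le (ISd n).
(* Uniformity in [d]: the chain in degree [d] is stationary from [nu d] on, the diagonal chain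
   [I (nu d) d] stops growing at some [d0], and a maximum over the degrees up to [d0] remains. *)
have [n0 n0I] : exists n0, forall d m, I m d `<=` I n0 d.
  have /choice[nu nuP] : forall d, exists n, forall m, I m d `<=` I n d.
    by move=> d; apply: (coarsely_noetherian_chain RN).
  have [d0 d0P] : exists d0, forall d, I (nu d) d `<=` I (nu d0) d0.
    apply: (coarsely_noetherian_chain RN (I := fun d => I (nu d) d)) => //.
    by move=> d a /ISd; exact: nuP.
  exists (\max_(d < d0.+1) nu d)%N => d m a /nuP Ia.
  have nu_le e : (e <= d0)%N -> (nu e <= \max_(d < d0.+1) nu d)%N.
    rewrite -ltnS => ed.
    exact: (@leq_bigmax _ (fun d : 'I_d0.+1 => nu d) (Ordinal ed)).
  have [dd0|/ltnW d0d] := leqP d d0; first exact: (Ilen _ _ _ (nu_le _ dd0)).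
  apply: (Iled _ _ _ d0d).
  by apply: (Ilen _ _ _ (nu_le _ (leqnn _))); exact: d0P Ia.
have [n2 [E [finE n2E]]] : exists n E, finite_set E /\
    forall m x, (L m `&` [set p : {poly R} | (size p <= D)%N]) x ->
      exists2 e, E e & (L n `&` [set p : {poly R} | (size p <= D)%N]) (x - e).
  apply: (coarsely_noetherian_poly_size (D := D) finX RN
    (L := fun m => L m `&` [set p : {poly R} | (size p <= D)%N]) finF).
  - by move=> n p [].
  - by move=> n p [/LS].
  - move=> n; have [L0 LB LX] := Lsub n; split.
    + by split=> //=; rewrite size_poly0.
    + move=> p q [Lp pD] [Lq qD]; have [f Ff Lf] := LB _ _ Lp Lq.
      exists f => //; split=> //; apply: size_polyD_le (FD _ Ff).
      exact: size_polyB_le.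
    + move=> _ p [c Xc <-] [Lp pD].
      have [|f Ff Lf] := LX c%:P p _ Lp; first by right; exists c.
      exists f => //; split=> //; apply: size_polyD_le (FD _ Ff).
      by rewrite mul_polyC (leq_trans (size_scale_leq _ _)).
pose n := maxn n0 n2; exists n.
(* Leading terms are cancelled by elements of [L n]. The number of cancellations depends on [p], but
   every error has size at most [D] and is absorbed by the remainder. *)
have red d m p : L m p -> (size p <= D + d)%N ->
    exists2 q, L n q & (size (p - q)%R <= D)%N.
  elim: d m p => [|d IH] m p Lp pd.
    by exists 0; [case: (Lsub n) | rewrite subr0; rewrite addn0 in pd].
  rewrite addnS in pd.
  have /n0I[q Lq [qd qp]] : I m d p`_(D + d) by exists p.
  have {}Lq : L n q := Lle _ _ (leq_maxl _ _) _ Lq.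
  have [_ LB _] := Lsub (maxn m n).
  have [f Ff Lf] := LB _ _ (Lle _ _ (leq_maxl _ _) _ Lp)
                           (Lle _ _ (leq_maxr _ _) _ Lq).
  have [|q' Lq' q'D] := IH _ _ Lf.
    apply: size_le_coef0; last by rewrite coefD coefB qp (Fcoef _ _ Ff) subrr addr0.
    by apply: size_polyD_le; [exact: size_polyB_le | exact/leqW/FDd].
  have [g [h [Fg Fh Lgh]]] := approx_submodule_add (Lsub n) Lq Lq'.
  exists (q + q' + (g - h)) => //.
  rewrite (_ : _ - _ = p - q + f - q' - f - g + h); last by ring.
  apply: size_polyD_le (FD _ Fh).
  exact: (size_polyB_le (size_polyB_le q'D (FD _ Ff)) (FD _ Fg)).
(* The errors come from subtracting [q], reducing the low remainder by [e], and adding [q] back. *)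
exists [set e - f | e in E & f in
  [set f + g | f in F & g in [set g - h | g in F & h in F]]]; split.
  apply: finite_image2 => //; apply: finite_image2 => //; exact: finite_image2.
move=> m p Lp; have [|q Lq pqD] := red (size p) m p Lp; first exact: leq_addl.
have [_ LB _] := Lsub (maxn m n).
have [f Ff Lf] := LB _ _ (Lle _ _ (leq_maxl _ _) _ Lp)
                         (Lle _ _ (leq_maxr _ _) _ Lq).
have [|e Ee [Le _]] := n2E (maxn m n) (p - q + f).
  by split=> //; apply: size_polyD_le => //; exact: FD.
have {}Le : L n (p - q + f - e) := Lle _ _ (leq_maxr _ _) _ Le.
have [g [h [Fg Fh Lgh]]] := approx_submodule_add (Lsub n) Lq Le.
exists (e - (f + (g - h))).
  exists e => //; exists (f + (g - h)) => //; exists f => //.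
  by exists (g - h) => //; exists g => //; exists h.
by move: Lgh; congr (L _ _); ring.
Qed.

End Hilbert.

(** * Polynomial rings acting through commuting endomorphisms *)

Section PolynomialEvaluation.
Variables (R : comNzRingType) (M : zmodType) (ev : R -> M -> M) (t : M -> M).
Hypothesis evB : forall p q m, ev (p - q) m = ev p m - ev q m.
Hypothesis tB : forall x y, t (x - y) = t x - t y.
Implicit Types p q : {poly R}.

(** Evaluation of [p] at the endomorphism [t], the coefficients acting through [ev]. *)
Definition poly_ev (p : {poly R}) (m : M) : M :=
  \sum_(i < size p) iter i t (ev p`_i m).

Let t0 : t 0 = 0. Proof. by rewrite -[X in t X](subrr 0) tB subrr. Qed.

Let ev0 m : ev 0 m = 0. Proof. by rewrite -[X in ev X](subrr 0) evB subrr. Qed.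

Let iterB i x y : iter i t (x - y) = iter i t x - iter i t y.
Proof. by elim: i => //= i ->; rewrite tB. Qed.

Let iter0 i : iter i t 0 = 0. Proof. by elim: i => //= i ->. Qed.

(** Padding with zero terms gives polynomials of different sizes a common range of summation. *)
Lemma poly_ev_wide n p m : (size p <= n)%N ->
  poly_ev p m = \sum_(i < n) iter i t (ev p`_i m).
Proof.
move=> pn; rewrite /poly_ev (big_ord_widen n (fun i => iter i t (ev p`_i m)))//.
rewrite big_mkcond; apply: eq_bigr => i _; case: ifP => // /negbT.
by rewrite -leqNgt => pi; rewrite nth_default// ev0 iter0.
Qed.

Lemma poly_evB p q m : poly_ev (p - q) m = poly_ev p m - poly_ev q m.
Proof.
have pn := leq_maxl (size p) (size q); have qn := leq_maxr (size p) (size q).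
rewrite (poly_ev_wide _ (size_polyB_le pn qn)).
rewrite (poly_ev_wide _ pn) (poly_ev_wide _ qn).
by rewrite -sumrB; apply: eq_bigr => i _; rewrite coefB evB iterB.
Qed.

Lemma poly_ev1 m : (forall m, ev 1 m = m) -> poly_ev 1 m = m.
Proof. by move=> ev1; rewrite /poly_ev size_poly1 big_ord1 coefC/= ev1. Qed.

Lemma additive_sum (u : M -> M) (uB : forall x y, u (x - y) = u x - u y) n
  (f : 'I_n -> M) : u (\sum_(i < n) f i) = \sum_(i < n) u (f i).
Proof.
have u0 : u 0 = 0 by rewrite -[X in u X](subrr 0) uB subrr.
apply: (big_morph u _ u0) => x y.
by rewrite -{1}[y]opprK -(sub0r y) uB uB u0 sub0r opprK.
Qed.

Lemma poly_evX p m : poly_ev ('X * p) m = t (poly_ev p m).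
Proof.
have pn : (size ('X * p)%R <= (size p).+1)%N.
  by rewrite (leq_trans (size_polyMleq _ _))// size_polyX.
rewrite (poly_ev_wide _ pn) big_ord_recl mulrC coefMX ev0 iter0 add0r.
by rewrite additive_sum//; apply: eq_bigr => i _; rewrite coefMX.
Qed.

Lemma poly_evC c (u : M -> M) p m : (forall x y, u (x - y) = u x - u y) ->
  (forall x, u (t x) = t (u x)) -> (forall a m, ev (c * a) m = u (ev a m)) ->
  poly_ev (c%:P * p) m = u (poly_ev p m).
Proof.
move=> uB ut evc.
have iu j x : iter j t (u x) = u (iter j t x).
  by elim: j => //= j ->; rewrite ut.
have pn : (size (c%:P * p)%R <= size p)%N by rewrite mul_polyC size_scale_leq.
rewrite (poly_ev_wide _ pn) additive_sum//; apply: eq_bigr => i _.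
by rewrite coefCM evc iu.
Qed.

End PolynomialEvaluation.

(** Induction on [s]: the integers act by multiples, and each further endomorphism adjoins one
    variable, the chain condition being preserved by the coarse Hilbert theorem. *)
Lemma commuting_endomorphisms_ring (I : eqType) (M : zmodType)
    (T : I -> M -> M) (s : seq I) :
  (forall i x y, T i (x - y) = T i x - T i y) ->
  (forall i j x, T i (T j x) = T j (T i x)) ->
  exists (R : comNzRingType) (X : set R) (ev : R -> M -> M),
  [/\ finite_set X /\ coarsely_noetherian X [set: R],
      forall p q m, ev (p - q) m = ev p m - ev q m,
      forall m, ev 1 m = m,
      forall c, X c ->
        exists2 i, i \in s & forall p m, ev (c * p) m = T i (ev p m) &
      forall i, i \in s ->
        exists2 c, X c & forall p m, ev (c * p) m = T i (ev p m)].
Proof.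
move=> TB TC; elim: s => [|i s [R [X [ev [[finX RN] evB ev1 XT TX]]]]].
  exists int, set0, (fun p m => m *~ p); split=> //.
  - by split; [exact: finite_set0 | exact: coarsely_noetherian_int].
  - by move=> p q m; rewrite mulrzBr.
pose ev' := poly_ev ev (T i).
exists {poly R}, ('X |` polyC @` X), ev'; split.
- split; last exact: coarsely_noetherian_poly.
  by rewrite finite_setU; split; [exact: finite_set1 | exact: finite_image].
- by move=> p q m; exact: poly_evB.
- by move=> m; exact: poly_ev1.
- move=> _ [->|[c Xc <-]].
    by exists i; [exact: mem_head | move=> p m; exact: poly_evX].
  have [j js jc] := XT _ Xc; exists j; first by rewrite inE js orbT.
  by move=> p m; exact: poly_evC.
- move=> j; rewrite inE => /predU1P[->|/TX[c Xc jc]].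
    by exists 'X; [left | move=> p m; exact: poly_evX].
  by exists c%:P; [right; exists c | move=> p m; exact: poly_evC].
Qed.

(** * Compact sets and translates in topological groups *)

Section TopologicalGroups.
Variable G : topologicalZmodType.
Implicit Types A B K W U : set G.

Lemma subr_continuous (h : G) : continuous (fun z : G => z - h).
Proof.
move=> x; apply: (@continuous_comp _ _ _ (fun z : G => (z, h))
  (fun p : G * G => p.1 - p.2)); last exact: sub_continuous.
by apply: cvg_pair; [exact: cvg_id | exact: cvg_cst].
Qed.

Lemma compact_image2 (S T : topologicalType) (f : S -> T -> G)
    (A : set S) (B : set T) : continuous (fun p : S * T => f p.1 p.2) ->
  compact A -> compact B -> compact [set f a b | a in A & b in B].
Proof.
move=> fc cA cB.
have -> : [set f a b | a in A & b in B] =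
    (fun p : S * T => f p.1 p.2) @` (A `*` B).
  apply/seteqP; split=> [_ [a Aa [b Bb <-]]|_ [[a b] [Aa Bb] <-]].
    by exists (a, b).
  by exists a => //; exists b.
apply: continuous_compact; last exact: compact_setX.
exact: continuous_subspaceT.
Qed.

Lemma compact_translates K W : compact K -> nbhs 0 W ->
  exists2 F, finite_set F & forall x, K x -> exists2 f, F f & W (x - f).
Proof.
move=> /compact_near_coveringP cK W0.
(* The filter of properties that hold for every set above some finite one; compactness along it
   provides the finite set of centres. *)
pose Fil : set_system (set G) :=
  [set P | exists2 F0, finite_set F0 & forall F, F0 `<=` F -> P F].
have FilF : Filter Fil.
  split.
  - by exists set0.
  - move=> P Q [F finF PF] [F' finF' QF']; exists (F `|` F').
      by rewrite finite_setU.
    move=> F'' FF''; split; [apply: PF | apply: QF'] => x Fx.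
      by apply: FF''; left.
    by apply: FF''; right.
  - by move=> P Q PQ [F finF PF]; exists F => // F' /PF /PQ.
have [|F finF KF] := cK _ Fil (fun F x => exists2 f, F f & W (x - f)) => //.
  move=> x Kx; exists ([set z | W (z - x)], [set F : set G | F x]).
    split=> /=.
      by apply: (@subr_continuous x x); rewrite subrr.
    by exists [set x] => // F; apply.
  by move=> [z F] /= [Wzx Fx]; exists x.
by exists F => // x Kx; exact: (KF F).
Qed.

Lemma LCA_compact_nbhs : LCA G -> exists2 W, nbhs (0 : G) W & compact W.
Proof.
move=> [_ /(_ 0 I) [W W0 [cW _]]]; exists W => //.
by move: W0; rewrite /within /=; apply: filterS => x; exact.
Qed.

Lemma closure_sub_add U W : nbhs 0 W ->
  forall x, closure U x -> exists2 u, U u & W (x - u).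
Proof.
move=> W0 x Ux.
have : nbhs x [set z | W (x - z)].
  have : continuous (fun z : G => x - z).
    move=> y; apply: (@continuous_comp _ _ _ (fun z : G => (x, z))
      (fun p : G * G => p.1 - p.2)); last exact: sub_continuous.
    by apply: cvg_pair; [exact: cvg_cst | exact: cvg_id].
  by move=> /(_ x); apply; rewrite subrr.
by move=> /Ux[u [Uu Wxu]]; exists u.
Qed.

Lemma closure_subgroup_translate U x h : is_subgroup U ->
  closure U x -> U h -> closure U (x - h).
Proof.
move=> [_ UB] Ux Uh B Bxh.
have /Ux[u [Uu Bu]] : nbhs x [set z | B (z - h)] by exact: subr_continuous.
by exists (u - h); split=> //; exact: UB.
Qed.

(** [F] is chosen so that [V - V] lies in [F + V0]; then [subgroup_gen F + V] is closed under
    subtraction and contains [K]. *)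
Lemma compactly_generated_cocompact : LCA G -> compactly_generated_group G ->
  exists F V : set G, [/\ finite_set F, compact V &
    forall a, exists2 g, subgroup_gen F g & V (a - g)].
Proof.
move=> lcG [K [cK genK]]; have [V0 V00 cV0] := LCA_compact_nbhs lcG.
pose V := K `|` V0.
have cV : compact V by exact: compactU.
have [F finF VF] : exists2 F, finite_set F &
    forall x, [set a - b | a in V & b in V] x -> exists2 f, F f & V0 (x - f).
  apply: compact_translates => //.
  apply: (compact_image2 (f := fun a b : G => a - b)) => //.
  exact: sub_continuous.
exists F, V; split=> // a.
have [genF0 genFB] : is_subgroup (subgroup_gen F).
  split=> [H [] //|x y Fx Fy H Hsub FH].
  by have [_ HB] := Hsub; apply: HB; [exact: Fx | exact: Fy].
have FV f : F f -> subgroup_gen F f by move=> Ff H _; exact.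
have : subgroup_gen K a by rewrite genK.
move=> /(_ [set a | exists2 g, subgroup_gen F g & V (a - g)]); apply;
  last first.
  by move=> x Kx; exists 0 => //; rewrite subr0; left.
split; first by exists 0 => //; rewrite subr0; right; exact: nbhs_singleton.
move=> x y [g Fg Vg] [h Fh Vh].
have [|f Ff Vf] := VF (x - g - (y - h)).
  by exists (x - g) => //; exists (y - h).
exists (g - h + f).
  rewrite -[f]opprK -[- f]sub0r; apply: (genFB); first exact: genFB.
  by apply: (genFB) => //; exact: FV.
right; move: Vf; congr (V0 _).
by rewrite !opprD !opprK !addrA (addrAC x (- g) (- y)).
Qed.

End TopologicalGroups.

(** * Transfer of the coarse chain condition to closed submodules *)

Theorem mainTheorem13 (A M : topologicalZmodType) (act : A -> M -> M) :
  LCA A -> compactly_generated_group A ->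
  LCA M -> LC_action act -> compactly_generated_module act ->
  forall Ms : nat -> set M,
    (forall n, closed (Ms n)) ->
    (forall n, is_submodule act (Ms n)) ->
    (forall n, Ms n `<=` Ms n.+1) ->
    exists n0 : nat, forall n : nat, (n0 <= n)%N ->
      cocompact_in (Ms n) (closure (\bigcup_i Ms i)).
Proof.
move=> lcA cgA lcM [actc act0 actA actD] [S [cS genS]] Ms _ Msub MsS.
have actm0 a : act a 0 = 0 by apply: (addrI (act a 0)); rewrite -actD !addr0.
have actN a x : act a (- x) = - act a x.
  by apply/eqP; rewrite -addr_eq0 -actD addNr actm0.
have actB a x y : act a (x - y) = act a x - act a y by rewrite actD actN.
have actC a b x : act a (act b x) = act b (act a x).
  by rewrite -!actA addrC.
have [_ [V [/finite_seqP[s1 ->] cV AV]]] :=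
  compactly_generated_cocompact lcA cgA.
(* With the opposites, stability under [s] passes to the subgroup generated by [s1]. *)
pose s := s1 ++ map -%R s1.
have [R [X [ev [[finX RN] evB ev1 XT TX]]]] :=
  commuting_endomorphisms_ring s actB actC.
have [W0 W00 cW0] := LCA_compact_nbhs lcM.
(* The second part accounts for the compact remainder [V] of [A] acting on the generators [S]. *)
pose W := W0 `|` [set act v x | v in V & x in S].
have W_0 : W 0 by left; exact: nbhs_singleton.
have cW : compact W by apply: compactU => //; exact: compact_image2.
(* [C] collects the defects of [W] as a submodule; finitely many translates of [W0] cover it, and
   their centres [sM] generate [N]. *)
pose C := [set x - y | x in W & y in W] `|`
          [set act a x | a in [set` s] & x in W].
have cC : compact C.
  apply: compactU; apply: compact_image2 => //; first exact: sub_continuous.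
  by apply: finite_compact; exact: finite_seq.
have [_ /finite_seqP[sM ->] CM] := compact_translates cC W00.
pose k := size sM.
have {}CM x : C x -> exists2 j, (j < k)%N & W (x - sM`_j).
  move=> /CM[f /= fsM Wf]; exists (index f sM); first by rewrite index_mem.
  by left; rewrite nth_index.
have CB x y : W x -> W y -> C (x - y).
  by move=> Wx Wy; left; exists x => //; exists y.
have Ca a x : a \in s -> W x -> C (act a x).
  by move=> sa Wx; right; exists a => //; exists x.
(* Polynomials of size at most [k] encode the free module [R^k]: ['X^i] only marks the [i]-th basis
   vector, sent to the [i]-th element of [sM]. *)
pose phi (p : {poly R}) := \sum_(i < k) ev p`_i sM`_i.
have phiB p q : phi (p - q) = phi p - phi q.
  by rewrite -sumrB; apply: eq_bigr => i _; rewrite coefB evB.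
have phi0 : phi 0 = 0 by rewrite -[X in phi X](subrr 0) phiB subrr.
have phiX j : (j < k)%N -> phi 'X^j = sM`_j.
  move=> jk; rewrite /phi (bigD1 (Ordinal jk))//= coefXn eqxx ev1 big1 ?addr0//.
  move=> i /eqP ij; rewrite coefXn; case: eqP => [ij'|_].
    by case: ij; apply/val_inj.
  by rewrite mulr0n -[X in ev X](subrr 0) evB subrr.
have phiC c a p : (forall p m, ev (c * p) m = act a (ev p m)) ->
    phi (c%:P * p) = act a (phi p).
  move=> ca; rewrite /phi additive_sum//.
  by apply: eq_bigr => i _; rewrite coefCM ca.
have sizeXn j : (j < k)%N -> (size ('X^j : {poly R}) <= k)%N.
  by rewrite size_polyXn.
(* [Q] is [N + W]; a defect in [C] is repaired by adding some ['X^j]. *)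
pose Q := [set x | exists2 p : {poly R}, (size p <= k)%N & W (x - phi p)].
have WQ : W `<=` Q by move=> x Wx; exists 0; rewrite ?size_poly0// phi0 subr0.
have QB x y : Q x -> Q y -> Q (x - y).
  move=> [p pk Wp] [q qk Wq]; have [j jk Wj] := CM _ (CB _ _ Wp Wq).
  exists (p - q + 'X^j).
    by apply: size_polyD_le; [exact: size_polyB_le | exact: sizeXn].
  move: Wj; congr (W _).
  rewrite -['X^j]opprK !phiB -[- 'X^j]sub0r phiB phi0 phiX//.
  by rewrite sub0r opprK !opprD !opprK !addrA (addrAC x (- phi p) (- y)).
have Qs a x : a \in s -> Q x -> Q (act a x).
  move=> sa [p pk Wp]; have [j jk Wj] := CM _ (Ca _ _ sa Wp).
  have [c Xc ca] := TX _ sa; exists (c%:P * p + 'X^j).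
    apply: size_polyD_le; last exact: sizeXn.
    by rewrite mul_polyC (leq_trans (size_scale_leq _ _)).
  move: Wj; congr (W _).
  rewrite -['X^j]opprK phiB -[- 'X^j]sub0r phiB phi0 phiX//.
  by rewrite (phiC _ _ _ ca) actB sub0r opprK opprD addrA.
have Qgen g : subgroup_gen [set` s1] g -> forall x, Q x -> Q (act g x).
  pose P := [set a | forall x, Q x -> Q (act a x) /\ Q (act (- a) x)].
  move=> /(_ P) gP x Qx; suff /gP : is_subgroup P.
    by case/(_ _ x Qx) => // a /= sa y Qy; split; apply: Qs => //;
      rewrite mem_cat ?sa// map_f ?orbT.
  split=> [y Qy|a b Pa Pb y Qy]; first by rewrite oppr0 act0.
  have [Qb Qnb] := Pb _ Qy; rewrite opprB (addrC b) !actA.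
  by split; [exact: (Pa _ Qnb).1 | exact: (Pa _ Qb).2].
have QT x : Q x.
  have : submodule_gen act S x by rewrite genS.
  suff : forall x, submodule_gen act S x -> forall a, Q (act a x).
    by move=> h /h /(_ 0); rewrite act0.
  (* The elements whose whole orbit lies in [Q] form a submodule. *)
  move=> {}x /(_ [set x | forall a, Q (act a x)]); apply; last first.
    move=> y Sy a; have [g gs Vg] := AV a.
    rewrite -(subrKC g a) actA; apply: Qgen => //.
    by apply: WQ; right; exists (a - g) => //; exists y.
  split; last by move=> a y Qy b; rewrite -actA.
  split=> [a|y z Qy Qz a]; first by rewrite actm0; exact: WQ.
  by rewrite actB; exact: QB.
have Msg n : is_subgroup (Ms n) := (Msub n).1.
have Ms0 n : Ms n 0 := (Msg n).1.
have MsB n x y : Ms n x -> Ms n y -> Ms n (x - y) by exact: (Msg n).2.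
(* The preimage of [Ms n + W]. Its defects are repaired by the elements [- 'X^j], the same for all
   [n]. *)
pose L n := [set p : {poly R} | (size p <= k)%N /\
  exists2 m, Ms n m & W (phi p - m)].
have [n0 [E [finE n0E]]] : exists n E, finite_set E /\
    forall m p, L m p -> exists2 e, E e & L n (p - e).
  apply: (coarsely_noetherian_poly_size (D := k) finX RN
    (F := (fun j => - 'X^j) @` `I_k)).
  - by apply: finite_image; exact: finite_II.
  - by move=> n p [].
  - by move=> n p [pk [m /MsS Mm Wm]]; split=> //; exists m.
  move=> n; split.
  - by split; [rewrite size_poly0 | exists 0; rewrite ?phi0 ?subr0].
  - move=> p q [pk [m Mm Wm]] [qk [m' Mm' Wm']].
    have [j jk Wj] := CM _ (CB _ _ Wm Wm'); exists (- 'X^j); first by exists j.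
    split; first by apply: size_polyB_le (sizeXn _ jk); exact: size_polyB_le.
    exists (m - m'); first exact: MsB.
    move: Wj; congr (W _); rewrite !phiB phiX// !opprD !opprK !addrA.
    by rewrite (ACl (1*3*5*2*4))/=.
  - move=> _ p [c Xc <-] [pk [m Mm Wm]]; have [a sa ca] := XT _ Xc.
    have [j jk Wj] := CM _ (Ca _ _ sa Wm); exists (- 'X^j); first by exists j.
    split.
      apply: size_polyB_le (sizeXn _ jk).
      by rewrite mul_polyC (leq_trans (size_scale_leq _ _)).
    exists (act a m); first exact: (Msub n).2.
    move: Wj; congr (W _); rewrite phiB phiX// (phiC _ _ _ ca) actB.
    by rewrite addrAC.
exists n0 => n n0n.
pose U := \bigcup_i Ms i.
have Usg : is_subgroup U.
  split=> [|x y [i _ Mx] [j _ My]]; first by exists 0%N.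
  exists (maxn i j) => //; apply: MsB.
    exact: (chain_le MsS (leq_maxl _ _) Mx).
  exact: (chain_le MsS (leq_maxr _ _) My).
have MU : Ms n `<=` U by move=> x Mx; exists n.
pose sum (B D : set M) := [set x + y | x in B & y in D].
have csum B D : compact B -> compact D -> compact (sum B D).
  by move=> cB cD; apply: compact_image2 => //; exact: add_continuous.
(* The summands will contain, in order, [y - x], [x - phi p], a generator, [phi e] and the final
   remainder. *)
pose K := sum W0 (sum W (sum [set` sM] (sum (phi @` E) W))).
have cK : compact K.
  apply: (csum) => //; apply: (csum) => //; apply: (csum).
    by apply: finite_compact; exact: finite_seq.
  by apply: (csum) => //; apply/finite_compact/finite_image.
exists (K `&` closure U); split.
  by apply: compact_closedI => //; exact: closed_closure.
apply/seteqP; split=> [y Uy|_ [h Mh [z [_ Uz] <-]]]; last first.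
  rewrite addrC -[h]opprK; apply: closure_subgroup_translate => //.
  by rewrite -sub0r; apply: Usg.2; [exact: Usg.1 | exact: MU].
have [x [i _ Mx] W0x] := closure_sub_add W00 Uy.
have [p pk Wp] := QT x.
(* [W] need not be symmetric, so reversing the sign of [x - phi p] costs one generator. *)
have [j jk Wj] := CM _ (CB _ _ W_0 Wp).
have [|e Ee [_ [m Mm Wm]]] := n0E i (p - 'X^j).
  split; first by apply: size_polyB_le => //; exact: sizeXn.
  exists x => //; move: Wj; congr (W _).
  by rewrite phiB phiX// sub0r opprB addrAC.
have {}Mm : Ms n m := chain_le MsS n0n Mm.
exists m => //; exists (y - m); last by rewrite subrKC.
split; last by apply: closure_subgroup_translate => //; exact: MU.
exists (y - x) => //; exists (x - m); last by rewrite addrA subrK.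
exists (x - phi p) => //; exists (phi p - m); last by rewrite addrA subrK.
exists sM`_j; first by rewrite /= mem_nth.
exists (phi p - m - sM`_j); last by rewrite subrKC.
exists (phi e); first by exists e.
eexists; first exact: Wm.
by rewrite !phiB phiX// (addrAC _ (- phi e)) subrKC addrAC.
Qed.
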